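(* Let $(X,\tau,d)$ be an extended metric-topological space and, for $\lambda>0$, let $\mathsf{HK}_{\lambda d}$ be the Hellinger-Kantorovich distance on $\mathcal M(X)$ induced by the distance $\lambda d$. For every $\mu_1,\mu_2\in\mathcal M(X)$, $$\mathsf{HK}_{\lambda d}(\mu_1,\mu_2)\uparrow\mathsf{Hell}(\mu_1,\mu_2)\quad\text{as }\lambda\uparrow\infty,$$ i.e. $\lambda\mapsto\mathsf{HK}_{\lambda d}(\mu_1,\mu_2)$ is nondecreasing and converges to $\mathsf{Hell}(\mu_1,\mu_2)$.
   Context: An extended metric-topological space $(X,\tau,d)$ is a Hausdorff space $(X,\tau)$ with an extended distance $d:X\times X\to[0,\infty]$ lower semicontinuous w.r.t. $\tau$. $\mathcal M(X)$ is the set of finite nonnegative Radon measures on $X$. Hellinger(-Kakutani) distance: $\mathsf{Hell}^2(\mu_1,\mu_2)=\int_X(\sqrt{\varrho_1}-\sqrt{\varrho_2})^2\,d\gamma$ for any $\gamma\in\mathcal M(X)$ with $\mu_i=\varrho_i\gamma\ll\gamma$. Hellinger-Kantorovich distance induced by an extended distance $d$: the cone $\mathfrak C$ is the quotient of $X\times[0,\infty)$ identifying all points $(x,0)$ to the vertex $\mathfrak o$; $d_{\mathfrak C}^2([x_1,r_1],[x_2,r_2])=r_1^2+r_2^2-2r_1r_2\cos(\min(d(x_1,x_2),\pi))$. Topology of $\mathfrak C$: that of $X\times(0,\infty)$ away from $\mathfrak o$, with the sets $\{[x,r]:r<\varepsilon\}$, $\varepsilon>0$, as neighborhood basis of $\mathfrak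 o$. $\mathsf r([x,r])=r$, $\mathsf x([x,r])=x$ if $r>0$, $\mathsf x(\mathfrak o)=\bar x$ a fixed point; on $\mathfrak C\times\mathfrak C$, $\mathsf x_i,\mathsf r_i$ refer to the $i$-th component. For a finite Radon measure $\alpha$ on $\mathfrak C\times\mathfrak C$ with $\int(\mathsf r_1^2+\mathsf r_2^2)\,d\alpha<\infty$, $\mathfrak h_i\alpha=(\mathsf x_i)_\sharp(\mathsf r_i^2\alpha)$. Then $\mathsf{HK}_d^2(\mu_1,\mu_2)=\min\{\int d_{\mathfrak C}^2\,d\alpha:\mathfrak h_1\alpha=\mu_1,\ \mathfrak h_2\alpha=\mu_2\}$ over such $\alpha$. *)

(* Defs.v *)
From HB Require Import structures.
From mathcomp Require Import all_boot all_order all_algebra.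
From mathcomp Require Import generic_quotient.
From mathcomp Require Import all_classical all_reals all_analysis.

Set Implicit Arguments.
Unset Strict Implicit.
Unset Printing Implicit Defensive.

Import Order.TTheory GRing.Theory Num.Theory.
Import numFieldNormedType.Exports.

Local Open Scope classical_set_scope.
Local Open Scope ring_scope.

Record ext_metric_topological (R : realType) (X : topologicalType)
    (d : X -> X -> \bar R) : Prop := ExtMetricTopological {
  emt_hausdorff : hausdorff_space X ;
  emt_ge0 : forall x y, (0 <= d x y)%E ;
  emt_eq0 : forall x y, d x y = 0%E <-> x = y ;
  emt_sym : forall x y, d x y = d y x ;
  emt_triangle : forall x y z, (d x z <= d x y + d y z)%E ;
  emt_lsc : lower_semicontinuous (fun p : X * X => d p.1 p.2)
}.

Definition scale_dist (R : realType) (X : Type) (l : R) (d : X -> X -> \bar R) :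
  X -> X -> \bar R := fun x y => (l%:E * d x y)%E.

(* The measurable sets of [borel T] are the Borel sets of the topology of [T].
   For a product space this is the Borel sigma-algebra of the product topology,
   not the product of the two Borel sigma-algebras. *)
Notation borel T := (g_sigma_algebraType (@open T)).

(* The library does not register this join of its two instances on products. *)
HB.instance Definition _ (T U : ptopologicalType) := Pointed.on (T * U)%type.

Definition radon (R : realType) (T : ptopologicalType)
    (mu : {finite_measure set (borel T) -> \bar R}) : Prop :=
  forall B : set (borel T), measurable B -> forall e : R, 0 < e ->
    exists K : set T, [/\ compact K, K `<=` B & (mu (B `\` K) <= e%:E)%E].

Section hellinger.
Context {R : realType} {X : ptopologicalType}.
Implicit Types mu gamma : {finite_measure set (borel X) -> \bar R}.

Definition is_density gamma (rho : borel X -> R) mu : Prop :=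
  [/\ measurable_fun setT rho, (forall x, 0 <= rho x) &
      forall A : set (borel X), measurable A ->
        mu A = (\int[gamma]_(x in A) (rho x)%:E)%E].

Definition hellinger2_values mu1 mu2 : set \bar R :=
  [set v | exists gamma (rho1 rho2 : borel X -> R),
    [/\ radon gamma, is_density gamma rho1 mu1, is_density gamma rho2 mu2 &
        v = (\int[gamma]_x
               ((Num.sqrt (rho1 x) - Num.sqrt (rho2 x)) ^+ 2)%:E)%E]].

(* The integral does not depend on [gamma] and the densities, and
   [mu1 + mu2] is always an admissible [gamma]: the set above is a singleton
   when [mu1] and [mu2] are Radon, and [xget] returns its element. *)
Definition hellinger2 mu1 mu2 : \bar R := xget 0%E (hellinger2_values mu1 mu2).

Definition Hell mu1 mu2 : \bar R := sqrte (hellinger2 mu1 mu2).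

End hellinger.

Section cone_quotient.
Variables (R : realType) (X : choiceType).
Local Open Scope quotient_scope.

Definition cone_eqv (p q : X * {nonneg R}) : bool :=
  (p == q) || ((p.2%:num == 0 :> R) && (q.2%:num == 0 :> R)).

Lemma cone_eqv_is_equiv : equiv_class_of cone_eqv.
Proof.
split=> [p|p q|q p r]; first by rewrite /cone_eqv eqxx.
- by rewrite /cone_eqv eq_sym andbC.
- rewrite /cone_eqv => /orP[/eqP-> //|/andP[p0 q0]].
  by move=> /orP[/eqP<-|/andP[_ r0]]; rewrite ?p0 ?q0 ?r0 orbT.
Qed.

Canonical cone_eqv_equiv := EquivRelPack cone_eqv_is_equiv.
Canonical cone_eqv_encModRel := defaultEncModRel cone_eqv.

Definition cone := {eq_quot cone_eqv}.
HB.instance Definition _ := Choice.on cone.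

Definition cone_point (x : X) (r : {nonneg R}) : cone :=
  \pi_{eq_quot cone_eqv} (x, r).

Definition cone_rad (c : cone) : R := (repr c).2%:num.

Definition cone_base (xbar : X) (c : cone) : X :=
  if cone_rad c == 0 then xbar else (repr c).1.

Lemma cone_point_eqv (p q : X * {nonneg R}) :
  (cone_point p.1 p.2 == cone_point q.1 q.2) = cone_eqv p q.
Proof.
by rewrite /cone_point -!surjective_pairing; rewrite eqmodE.
Qed.

Lemma cone_reprK (x : X) (r : {nonneg R}) :
  cone_eqv (repr (cone_point x r)) (x, r).
Proof.
by rewrite -cone_point_eqv /= /cone_point -surjective_pairing reprK.
Qed.

Lemma cone_radE (x : X) (r : {nonneg R}) : cone_rad (cone_point x r) = r%:num.
Proof.
by rewrite /cone_rad; have /orP[/eqP->|/andP[/eqP-> /eqP/=->]] := cone_reprK x r.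
Qed.

Lemma cone_baseE (xbar x : X) (r : {nonneg R}) :
  cone_base xbar (cone_point x r) = if r%:num == 0 :> R then xbar else x.
Proof.
rewrite /cone_base cone_radE; case: ifPn => // r0.
by have /orP[/eqP->|/andP[_ /= r0']] := cone_reprK x r; last by rewrite r0' in r0.
Qed.

End cone_quotient.

Section cone_topology.
Variables (R : realType) (X : ptopologicalType).

Definition cone_vertex : cone R X := cone_point point (0%:nng : {nonneg R}).

(* The first clause says that the trace of [U] on the cone minus its vertex,
   identified with [X * ]0, +oo[], is open; as [X * ]0, +oo[] is open in
   [X * R], openness can be tested there. This topology is in general coarser
   than the quotient topology. *)
Definition cone_open (U : set (cone R X)) : Prop :=
  open [set p : X * R | exists r : {nonneg R},
          [/\ 0 < r%:num, r%:num = p.2 & U (cone_point p.1 r)]] /\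
  (U cone_vertex ->
    exists2 e : R, 0 < e & [set c | cone_rad c < e] `<=` U).

Lemma cone_openT : cone_open setT.
Proof.
split; last by move=> _; exists 1.
rewrite (_ : [set _ | _] = snd @^-1` [set r : R | 0 < r]).
  by apply: open_comp => [? _|]; [exact: cvg_snd|exact: open_gt].
apply/seteqP; split => [[x r]/= [s [s0 <- _]]//|[x r]/= r0].
by exists (NngNum (ltW r0)).
Qed.

Lemma cone_openI : setI_closed cone_open.
Proof.
move=> U V [oU vU] [oV vV]; split.
  have := openI oU oV; congr open; apply/seteqP; split=> [[x r]|[x r]] /=.
    move=> [[s [s0 sr Us]] [t [t0 tr Vt]]]; exists s; split=> //; split=> //.
    by rewrite (_ : s = t)//; apply/val_inj; rewrite /= sr tr.
  by move=> [s [s0 sr [Us Vs]]]; split; exists s.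
move=> [/vU[e e0 eU] /vV[f f0 fV]]; exists (Num.min e f).
  by rewrite lt_min e0.
by move=> c /=; rewrite lt_min => /andP[ce cf]; split; [exact: eU|exact: fV].
Qed.

Lemma cone_open_bigU (I : Type) (F : I -> set (cone R X)) :
  (forall i, cone_open (F i)) -> cone_open (\bigcup_i F i).
Proof.
move=> oF; split.
  have := bigcup_open (fun i (_ : setT i) => (oF i).1).
  congr open; apply/seteqP; split=> [[x r]|[x r]] /=.
    by move=> [i _ [s [s0 sr Fs]]]; exists s; split=> //; exists i.
  by move=> [s [s0 sr [i _ Fs]]]; exists i => //; exists s.
by move=> [i _ /(oF i).2[e e0 eF]]; exists e => // c /eF; exists i.
Qed.

HB.instance Definition _ := isOpenTopological.Build (cone R X)
  cone_openT cone_openI cone_open_bigU.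
HB.instance Definition _ := isPointed.Build (cone R X) cone_vertex.

End cone_topology.

Section hellinger_kantorovich.
Context {R : realType} {X : ptopologicalType}.
Variables (xbar : X) (d : X -> X -> \bar R).
Local Notation C := (cone R X).
Implicit Types mu : {finite_measure set (borel X) -> \bar R}.
Implicit Types alpha : {finite_measure set (borel (C * C)%type) -> \bar R}.

(* When a radius vanishes the cosine is multiplied by 0, so the value does not
   depend on [xbar]. *)
Definition cone_dist2 (c1 c2 : C) : R :=
  cone_rad c1 ^+ 2 + cone_rad c2 ^+ 2 -
  2 * cone_rad c1 * cone_rad c2 *
    cos (fine (Order.min (d (cone_base xbar c1) (cone_base xbar c2)) pi%:E)).

(* [pr] is the projection of [C * C] onto its first or second factor. *)
Definition homogeneous_marginal (pr : C * C -> C) alpha :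
    set (borel X) -> \bar R :=
  pushforward
    (fun B : set (borel (C * C)%type) =>
       (\int[alpha]_(y in B) (cone_rad (pr y) ^+ 2)%:E)%E)
    (fun y : borel (C * C)%type => cone_base xbar (pr y) : borel X).

Definition HK_plan mu1 mu2 alpha : Prop :=
  [/\ radon (T := (C * C)%type) alpha,
      (\int[alpha]_y (cone_rad y.1 ^+ 2 + cone_rad y.2 ^+ 2)%:E < +oo)%E,
      (forall A : set (borel X), measurable A ->
         homogeneous_marginal fst alpha A = mu1 A) &
      (forall A : set (borel X), measurable A ->
         homogeneous_marginal snd alpha A = mu2 A)].

Definition HK2 mu1 mu2 : \bar R :=
  ereal_inf [set (\int[alpha]_y (cone_dist2 y.1 y.2)%:E)%E |
             alpha in HK_plan mu1 mu2].

Definition HK mu1 mu2 : \bar R := sqrte (HK2 mu1 mu2).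

End hellinger_kantorovich.

(* Main.v *)
Require Import Defs.
From mathcomp Require Import all_boot all_order all_algebra.
From mathcomp Require Import all_classical all_reals all_analysis.
From mathcomp Require Import measurable_realfun.
From mathcomp Require Import ring lra.

Set Implicit Arguments.
Unset Strict Implicit.

Import Order.TTheory GRing.Theory Num.Theory.
Import numFieldNormedType.Exports.

Local Open Scope classical_set_scope.
Local Open Scope ring_scope.

(** The admissible plans do not depend on the distance, only the cost does,
    and the cost grows with the scale because the cosine decreases on [0, pi]:
    this gives the monotonicity. For the limit, let rho_i be densities of mu_i
    with respect to a Radon measure gamma, and s_i the square root of rho_i.

    Upper bound. The image of gamma under x |-> ([x, s_1 x], [x, s_2 x]) is a
    plan, and as d x x = 0 its cost is the Hellinger integral, whatever the
    scale ([HK2_le_hellinger]). That the image is a Radon measure rests on a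
    Lusin theorem: s_1 and s_2 are continuous on large compact sets, whose
    images are compact ([radon_lusin], [radon_graph_image]).

    Lower bound. Expanding the square, the Hellinger integral is the total
    mass of mu_1 and mu_2 minus twice the integral of s_1 s_2
    ([hellinger_affinity]). So it is enough to bound the cost of every plan from
    below by

      mu_1(X) + mu_2(X) - int a dmu_1 - int b dmu_2

    where int a dmu_1 + int b dmu_2 is close to 2 int s_1 s_2 dgamma. By weak
    duality ([plan_cost_ge_dual]) this holds for nonnegative a and b such that
    r^2 + s^2 <= cost([x, r], [y, s]) + a x r^2 + b y s^2. Over the diagonal
    the best choice is a = s_2 / s_1 and b = s_1 / s_2, by Young's inequality
    2 r s <= k r^2 + k^-1 s^2. For a small t > 0 put
    theta = (s_2 + t) / (s_1 + t), take a = (1 + t) theta and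
    b = (1 + t) / theta, and add a penalty which is small on mu_1 and mu_2 and
    makes the inequality trivial outside a compact K on which theta is
    continuous. On K, points where theta differs by a factor more than 1 + t
    are uniformly apart for d: by compactness, lower semicontinuity of d and
    d > 0 off the diagonal ([compact_unif_continuous_lsc]). A large scale
    brings the distance of such points to at least pi, where the cost is at least
    r^2 + s^2 ([potentials_eventually_admissible]). *)

(** * Integrals of functions that need not be measurable *)

Section integral_toolbox.
Local Open Scope ereal_scope.
Import HBNNSimple.

(** The integral of a nonnegative function is the supremum of the integrals of
    the simple functions below it, so it is monotone without measurability. The
    costs below are then compared without a measurability proof for the
    distance. *)
Lemma ge0_le_integralT d (T : measurableType d) (R : realType)
    (m : {measure set T -> \bar R}) (f g : T -> \bar R) :
  (forall x, 0 <= f x) -> (forall x, f x <= g x) ->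
  \int[m]_x f x <= \int[m]_x g x.
Proof.
move=> f0 fg; have g0 x : 0 <= g x by exact: le_trans (f0 x) (fg x).
rewrite !ge0_integralTE//.
apply: le_ereal_sup => _ [h /= hf <-]; exists h => // x.
exact: le_trans (hf x) (fg x).
Qed.

(** For a function that may fail to be measurable only one inequality of the
    change of variables survives: a simple function below [f] pulls back to a
    simple function below [f \o p], but not every one arises in this way. *)
Lemma integral_pushforward_le d1 d2 (T1 : measurableType d1)
    (T2 : measurableType d2) (R : realType) (m : {measure set T1 -> \bar R})
    (m' : {measure set T2 -> \bar R})
    (p : T1 -> T2) (mp : measurable_fun setT p) (f : T2 -> \bar R) :
  (m' = pushforward m p :> (set T2 -> \bar R)) ->
  (forall y, 0 <= f y) ->
  \int[m']_y f y <= \int[m]_x f (p x).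
Proof.
move=> m'E f0.
rewrite ge0_integralTE//; apply: ub_ereal_sup => _ [h /= hf <-].
rewrite -integralT_nnsfun (eq_measure_integral (pushforward m p)); last first.
  by move=> A _ _; rewrite m'E.
rewrite ge0_integral_pushforward//=.
- by rewrite preimage_setT; apply: ge0_le_integralT => // x /=; rewrite lee_fin.
- exact/measurable_EFinP.
- by move=> y _ /=; rewrite lee_fin.
Qed.

(** Covers both an integral against a measure with density ([p = id]) and an
    integral against a homogeneous marginal ([p] the base point, [w] the squared
    radius). *)
Lemma ge0_integral_weight d1 d2 (T1 : measurableType d1)
    (T2 : measurableType d2) (R : realType) (m : {measure set T1 -> \bar R})
    (nu : {measure set T2 -> \bar R}) (p : T1 -> T2) (w : T1 -> R)
    (f : T2 -> \bar R) :
  measurable_fun setT p -> measurable_fun setT w -> (forall x, (0 <= w x)%R) ->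
  (forall A, measurable A -> nu A = \int[m]_(x in p @^-1` A) (w x)%:E) ->
  measurable_fun setT f -> (forall y, 0 <= f y) ->
  \int[nu]_y f y = \int[m]_x (f (p x) * (w x)%:E).
Proof.
move=> mp mw w0 nuE mf f0.
have mew : measurable_fun setT (fun x => (w x)%:E) by exact/measurable_EFinP.
have simple (h : {nnsfun T2 >-> R}) :
    \int[nu]_y (h y)%:E = \int[m]_x ((h (p x))%:E * (w x)%:E).
  rewrite integralT_nnsfun sintegralE.
  under [RHS]eq_integral => x _.
    rewrite (fimfunE h (p x)) -fsumEFin// ge0_mule_fsuml; last first.
      by move=> r; rewrite -?EFinM lee_fin; exact: nnfun_muleindic_ge0.
    over.
  rewrite ge0_integral_fsum//=; first last.
  - move=> r x _; rewrite -EFinM lee_fin mulr_ge0//.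
    by have := nnfun_muleindic_ge0 h r (p x); rewrite lee_fin.
  - move=> r; apply: emeasurable_funM => //; apply/measurable_EFinP.
    by apply: measurable_funM => //; apply: measurableT_comp => //.
  apply: eq_fsbigr => r; rewrite inE => -[y _ hy].
  have mh : measurable (h @^-1` [set r]) by exact: measurable_sfunP.
  have r0 : (0 <= r)%R by rewrite -hy.
  rewrite nuE// integral_mkcond -ge0_integralZl//; first last.
  - by move=> x _; apply: erestrict_ge0 => // t _; rewrite lee_fin.
  - apply/(measurable_restrictT _ _).1.
      by rewrite -[X in measurable X]setTI; exact: mp.
    exact: measurable_funTS.
  apply: eq_integral => x _; rewrite patchE indicE.
  rewrite (_ : (x \in p @^-1` _) = (p x \in h @^-1` [set r])); last first.
    by apply/idP/idP; rewrite !inE.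
  by case: ifPn => _; rewrite ?mulr1 ?mulr0 ?mule0 ?mul0e.
pose h := nnsfun_approx measurableT mf.
transitivity (limn (fun n => \int[nu]_y (h n y)%:E)).
  rewrite -monotone_convergence//=.
  - apply: eq_integral => y _; apply/esym/cvg_lim => //.
    exact: cvg_nnsfun_approx.
  - by move=> n; exact/measurable_EFinP.
  - by move=> n y _; rewrite lee_fin.
  - by move=> y _ a b ab; rewrite lee_fin; exact/lefP/nd_nnsfun_approx.
under eq_fun do rewrite simple.
rewrite -monotone_convergence//=.
- apply: eq_integral => x _; apply/cvg_lim => //.
  by apply: cvgeZr => //; exact: cvg_nnsfun_approx.
- move=> n; apply: emeasurable_funM => //; apply/measurable_EFinP.
  exact: measurableT_comp.
- by move=> n y _; rewrite -EFinM lee_fin mulr_ge0.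
- move=> y _ a b ab; rewrite -!EFinM lee_fin ler_wpM2r//.
  exact/lefP/nd_nnsfun_approx.
Qed.

(** Restriction to the whole space repackages a measure of finite mass as a
    term of the finite measure structure. *)
Lemma finite_measure_of_lty d (T : measurableType d) (R : realType)
    (P : {measure set T -> \bar R}) : P setT < +oo ->
  exists m : {finite_measure set T -> \bar R}, forall A, m A = P A.
Proof.
move=> PT; exists (mfrestr measurableT PT) => A.
by rewrite /= /mfrestr /mrestr setIT.
Qed.

Lemma finite_measure_sum d (T : measurableType d) (R : realType)
    (m1 m2 : {finite_measure set T -> \bar R}) :
  exists m : {finite_measure set T -> \bar R}, forall A, m A = m1 A + m2 A.
Proof.
have [|m mE] := @finite_measure_of_lty _ _ _ (measure_add m1 m2).
  rewrite [ltLHS](measure_addE m1 m2).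
  by rewrite lte_add_pinfty// ltey_eq fin_num_measure.
by exists m => A; rewrite mE; exact: measure_addE.
Qed.

Lemma finite_measure_pushforward d1 d2 (T1 : measurableType d1)
    (T2 : measurableType d2) (R : realType)
    (m : {finite_measure set T1 -> \bar R}) (p : T1 -> T2) :
  measurable_fun setT p ->
  exists m' : {finite_measure set T2 -> \bar R},
    m' = pushforward m p :> (set T2 -> \bar R).
Proof.
move=> mp.
have [P PE] : exists P : {measure set T2 -> \bar R},
    P = pushforward m p :> (set T2 -> \bar R).
  by unshelve eexists (pushforward m p).
have [|m' m'E] := @finite_measure_of_lty _ _ _ P.
  by rewrite PE /pushforward preimage_setT ltey_eq fin_num_measure.
by exists m'; apply/funext => A; rewrite m'E PE.
Qed.

End integral_toolbox.

Section real_integrals.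
Local Open Scope ereal_scope.
Context d (T : measurableType d) (R : realType) (m : {measure set T -> \bar R}).
Implicit Types f g : T -> R.

Lemma ge0_integral_addr f g :
  measurable_fun setT f -> measurable_fun setT g ->
  (forall x, 0 <= f x)%R -> (forall x, 0 <= g x)%R ->
  \int[m]_x (f x + g x)%:E = \int[m]_x (f x)%:E + \int[m]_x (g x)%:E.
Proof.
move=> mf mg f0 g0; under eq_integral do rewrite EFinD.
by rewrite ge0_integralD//; try (move=> *; rewrite lee_fin//);
  exact/measurable_EFinP.
Qed.

Lemma ge0_integral_mulr (k : R) f :
  measurable_fun setT f -> (0 <= k)%R -> (forall x, 0 <= f x)%R ->
  \int[m]_x (k * f x)%:E = k%:E * \int[m]_x (f x)%:E.
Proof.
move=> mf k0 f0; under eq_integral do rewrite EFinM.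
by rewrite ge0_integralZl//; [exact/measurable_EFinP|move=> *; rewrite lee_fin].
Qed.

End real_integrals.

(** * Lusin's theorem for Radon measures *)

Section borel_facts.
Context {X : ptopologicalType}.

Lemma open_borel (U : set X) : open U -> measurable (U : set (borel X)).
Proof. by move=> oU; exact: sub_sigma_algebra. Qed.

Lemma closed_borel (C : set X) : closed C -> measurable (C : set (borel X)).
Proof.
move=> cC; rewrite -[C]setCK; apply: measurableC.
by apply: open_borel; exact: closed_openC.
Qed.

Lemma borel_measurable_open d (T : measurableType d) (f : T -> borel X) :
  (forall U : set X, open U -> measurable (f @^-1` U)) -> measurable_fun setT f.
Proof.
move=> fU; apply: (@measurability _ _ T (borel X) setT f (@open X)) => //.
by move=> _ [U oU <-]; rewrite setTI; exact: fU.
Qed.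

Lemma borel_measurable_ray (R : realType) (f : X -> R) :
  (forall a : R, open [set x | a < f x]) ->
  measurable_fun setT (f : borel X -> R).
Proof.
move=> fo.
apply: (measurability _ (RGenOInfty.measurableE R)) => _ [_ [a ->] <-].
rewrite setTI; apply: open_borel.
by rewrite (_ : _ @^-1` _ = [set x | a < f x])//; apply/seteqP; split => x /=;
  rewrite in_itv/= andbT.
Qed.

Lemma measurable_sqrt_comp (R : realType) (f : borel X -> R) :
  measurable_fun setT f -> measurable_fun setT (fun x => Num.sqrt (f x)).
Proof.
move=> mf; apply: measurableT_comp => //.
by apply: continuous_measurable_fun; exact: sqrt_continuous.
Qed.

End borel_facts.

Section lusin.
Context {R : realType} {X : ptopologicalType}.
Hypothesis hX : hausdorff_space X.

(** For each rational [q], inner regularity gives compact sets inside [f > q]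
    and inside its complement which together miss little mass. On the
    intersection of these unions the sets [f > q] are relatively clopen, so [f]
    is continuous there. *)
Lemma radon_lusin (m : {finite_measure set (borel X) -> \bar R})
    (f : borel X -> R) (e : R) : radon m -> measurable_fun setT f -> 0 < e ->
  exists K : set X,
    [/\ compact K, (m (~` K) <= e%:E)%E & {within K, continuous (f : X -> R)}].
Proof.
move=> rm mf e0.
pose q n : R := ratr (odflt 0%Q (unpickle n)).
pose A n : set (borel X) := [set x | q n < f x].
have mA n : measurable (A n).
  rewrite -[A n]setTI (_ : A n = f @^-1` `]q n, +oo[).
    by apply: mf.
  by apply/seteqP; split => x /=; rewrite in_itv/= andbT.
pose e' n := e / (2 ^ n.+1)%:R / 2.
have e'0 n : 0 < e' n by rewrite !divr_gt0// ltr0n expn_gt0.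
have /choice[K_ KP] n := rm (A n) (mA n) (e' n) (e'0 n).
have /choice[L_ LP] n := rm (~` A n) (measurableC (mA n)) (e' n) (e'0 n).
have cK n : closed (K_ n) by case: (KP n) => + _ _; exact: compact_closed.
have cL n : closed (L_ n) by case: (LP n) => + _ _; exact: compact_closed.
pose K := \bigcap_n (K_ n `|` L_ n).
have clK : closed K by apply: closed_bigI => n _; exact: closedU.
exists K; split.
- apply: (@subclosed_compact _ K (K_ 0%N `|` L_ 0%N)) => //.
    by apply: compactU; [case: (KP 0%N)|case: (LP 0%N)].
  by move=> x; apply.
(* the missed masses add up to a geometric series *)
- pose F n : set (borel X) := ~` (K_ n `|` L_ n).
  have mF n : measurable (F n).
    by apply: measurableC; apply: closed_borel; exact: closedU.
  have FE : (~` K) `<=` \bigcup_n F n by rewrite setC_bigcap.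
  have mK : measurable (~` K : set (borel X)).
    by apply: measurableC; exact: closed_borel.
  have XX := measure_sigma_subadditive m mF mK FE.
  apply: (le_trans XX).
  
  apply: (le_trans _ (epsilon_trick0 xpredT (ltW e0))).
  apply: lee_nneseries => // n _.
  have -> : e / (2 ^ n.+1)%:R = e' n + e' n by rewrite /e' -splitr.
  case: (KP n) => _ KA Ke; case: (LP n) => _ LA Le.
  rewrite EFinD; apply: (le_trans _ (leeD Ke Le)).
  have mAK : measurable (A n `\` K_ n).
    by apply: measurableD => //; exact: closed_borel.
  have mAL : measurable (~` A n `\` L_ n).
    by apply: measurableD; [exact: measurableC|exact: closed_borel].
  apply: (le_trans _ (measureU2 _ mAK mAL)).
  apply: le_measure; rewrite ?inE//; first exact: measurableU.
  move=> x /= /not_orP[nK nL]; have [Ax|nAx] := pselect (A n x); first by left.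
  by right.
- apply/subspace_continuousP => x Kx.
  apply/(@cvgrPdist_lt _ R^o) => eps eps0.
  have xe : f x - eps < f x by rewrite ltrBlDr ltrDl.
  have ex : f x < f x + eps by rewrite ltrDl.
  (* two rational levels near [f x] confine [f] near [x] within [K] *)
  have [p] := rat_in_itvoo xe.
  move=> /andP[]; rewrite !bnd_simp => epx pfx.
  have [r] := rat_in_itvoo ex.
  move=> /andP[]; rewrite !bnd_simp => fxr rxe.
  have qp : q (pickle p) = ratr p by rewrite /q pickleK.
  have qr : q (pickle r) = ratr r by rewrite /q pickleK.
  have xL : ~ L_ (pickle p) x.
    by case: (LP (pickle p)) => _ LA _ /LA; apply; rewrite /A /= qp.
  have xK : ~ K_ (pickle r) x.
    by case: (KP (pickle r)) => _ KA _ /KA; rewrite /A /= qr ltNge (ltW fxr).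
  have nL : nbhs x (~` L_ (pickle p)).
    by apply: open_nbhs_nbhs; split => //; exact: closed_openC.
  have nK : nbhs x (~` K_ (pickle r)).
    by apply: open_nbhs_nbhs; split => //; exact: closed_openC.
  rewrite near_withinE; near=> y => Ky.
  have Ly : ~ L_ (pickle p) y by near: y.
  have Kry : ~ K_ (pickle r) y by near: y.
  have pfy : ratr p < f y.
    have [Kpy|//] := Ky (pickle p) I.
    by case: (KP (pickle p)) => _ KA _; have := KA _ Kpy; rewrite /A /= qp.
  have fyr : f y <= ratr r.
    have [//|Lry] := Ky (pickle r) I.
    case: (LP (pickle r)) => _ LA _; have /negP := LA _ Lry.
    by rewrite /= qr -leNgt.
  change (`|f x - f y| < eps).
  rewrite ltr_distl; apply/andP; split.
    by rewrite ltrBlDr; lra.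
  by lra.
Unshelve. all: by end_near. Qed.

End lusin.

(** * Uniform continuity with respect to a lower semicontinuous distance *)

Section uniform.
Context {R : realType} {X : ptopologicalType}.
Variable d : X -> X -> \bar R.
Hypothesis hd : ext_metric_topological d.

(** Near-covering argument on [K `*` K]: close to a diagonal point the values
    of [g] are close to each other, and close to any other point [d] stays above
    a positive constant by lower semicontinuity. *)
Lemma compact_unif_continuous_lsc (K : set X) (g : X -> R) (e : R) :
  compact K -> {within K, continuous g} -> 0 < e ->
  exists2 c : R, 0 < c &
    forall x y, K x -> K y -> (d x y < c%:E)%E -> `|g x - g y| < e.
Proof.
move=> cK /subspace_continuousP cg e0.
have /compact_near_coveringP cov := compact_setX cK cK.
pose P (c : R) (p : X * X) := K p.1 -> K p.2 -> (d p.1 p.2 < c%:E)%E ->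
  `|g p.1 - g p.2| < e.
suff near_cov p : (K `*` K) p ->
    \forall p' \near p & c \near (0 : R)^'+, P c p'.
  have nearP := cov R (0 : R)^'+ P _ near_cov.
  have [c [c0 Pc]] : exists c : R, 0 < c /\ K `*` K `<=` P c.
    apply: (@filter_ex _ (0 : R)^'+); near=> c; split.
      by near: c; exact: nbhs_right_gt.
    by near: c; exact: nearP.
  by exists c => // x y Kx Ky; exact: (Pc (x, y)).
case: p => x y [/= Kx Ky]; have [<-{y Ky}|xy] := pselect (x = y).
  have gx : \forall y \near x, K y -> `|g x - g y| < e / 2.
    have /(@cvgrPdist_lt _ R^o)/(_ (e / 2)) := cg x Kx.
    by rewrite divr_gt0// near_withinE; exact.
  exists ([set p' : X * X | (K p'.1 -> `|g x - g p'.1| < e / 2) /\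
                           (K p'.2 -> `|g x - g p'.2| < e / 2)], setT) => /=.
    split; last exact: filterT.
    by exists ([set y | K y -> `|g x - g y| < e / 2],
              [set y | K y -> `|g x - g y| < e / 2]).
  move=> [[y z] c] /= [[gy gz] _] Ky Kz _.
  have := gy Ky; have := gz Kz; rewrite /= !ltr_distl => /andP[? ?] /andP[? ?].
  by apply/andP; split; lra.
have [r r0 rd] : exists2 r : R, 0 < r & (r%:E < d x y)%E.
  have : (0 < d x y)%E.
    by rewrite lt0e (emt_ge0 hd) andbT; apply/eqP => /(emt_eq0 hd).
  case: (d x y) => [r||//].
    rewrite lte_fin => r0; exists (r / 2); first by rewrite divr_gt0.
    by rewrite lte_fin ltr_pdivrMr// ltr_pMr// ltr1n.
  by exists 1; rewrite ?ltry.
have [V nV Vd] := @emt_lsc _ _ _ hd (x, y) r rd.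
exists (V, [set c | c < r]) => /=.
  by split => //; exact: nbhs_right_lt.
move=> [p c] /= [Vp cr] _ _ dc.
by have := lt_trans (Vd p Vp) dc; rewrite lte_fin ltNge (ltW cr).
Unshelve. all: by end_near. Qed.

End uniform.

(** * Topology of the cone *)

(** The absolute value extends [cone_point] to all real radii, so that
    continuity can be stated on the product [X * R]. *)
Definition absnng {R : realType} (a : R) : {nonneg R} := NngNum (normr_ge0 a).

Section cone_top.
Context {R : realType} {X : ptopologicalType}.
Local Notation C := (cone R X).

(** The trace of [U] away from the vertex only has to be described by an open
    subset [O] of [X * R], with no constraint on [O] at radii [<= 0]. *)
Lemma open_cone (U : set C) (O : set (X * R)) : open O ->
  (forall x (r : {nonneg R}), 0 < r%:num ->
     U (cone_point x r) <-> O (x, r%:num)) ->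
  (U (cone_vertex R X) ->
     exists2 e : R, 0 < e & [set c | cone_rad c < e] `<=` U) ->
  open U.
Proof.
move=> oO UO vU; suff : cone_open U by [].
split => //.
have oP : open [set p : X * R | 0 < p.2].
  have : open (@snd X R @^-1` [set r : R | 0 < r]).
    by apply: open_comp; [move=> ? _; exact: cvg_snd|exact: open_gt].
  by [].
have := openI oO oP; congr open; apply/seteqP; split=> [[x r]|[x r]] /=.
  move=> [Oxr r0]; exists (NngNum (ltW r0)); split => //.
  by apply/(UO _ (NngNum (ltW r0))).
by move=> [s [s0 <- Us]]; split => //; exact/UO.
Qed.

Lemma cone_pointK (c : C) : c = cone_point (repr c).1 (repr c).2.
Proof. by rewrite /cone_point -surjective_pairing reprK. Qed.

Lemma cone_rad_ge0 (c : C) : 0 <= cone_rad c.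
Proof. by rewrite /cone_rad. Qed.

Lemma cone_rad_vertex : cone_rad (cone_vertex R X) = 0.
Proof. by rewrite cone_radE. Qed.

Lemma cone_rad0 (c c' : C) : cone_rad c = 0 -> cone_rad c' = 0 -> c = c'.
Proof.
rewrite (cone_pointK c) (cone_pointK c') !cone_radE => c0 c'0.
apply/eqP; rewrite (cone_point_eqv (_, _) (_, _)) /cone_eqv /= c0 c'0 eqxx.
by rewrite orbT.
Qed.

Lemma open_cone_rad_gt (a : R) : open [set c : C | a < cone_rad c].
Proof.
apply: (@open_cone _ (@snd X R @^-1` [set r : R | a < r])).
- by apply: open_comp; [move=> ? _; exact: cvg_snd|exact: open_gt].
- by move=> x r r0 /=; rewrite cone_radE.
- rewrite /= cone_rad_vertex => a0; exists 1 => // c _ /=.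
  exact: lt_le_trans a0 (cone_rad_ge0 c).
Qed.

Lemma open_cone_rad_lt (a : R) : open [set c : C | cone_rad c < a].
Proof.
apply: (@open_cone _ (@snd X R @^-1` [set r : R | r < a])).
- by apply: open_comp; [move=> ? _; exact: cvg_snd|exact: open_lt].
- by move=> x r r0 /=; rewrite cone_radE.
- by rewrite /= cone_rad_vertex => a0; exists a.
Qed.

Lemma open_cone_base (xbar : X) (U : set X) : open U ->
  open [set c : C | 0 < cone_rad c /\ U (cone_base xbar c)].
Proof.
move=> oU; apply: (@open_cone _ (@fst X R @^-1` U)).
- by apply: open_comp => // ? _; exact: cvg_fst.
- move=> x r r0 /=; rewrite cone_radE cone_baseE gt_eqF//; split => [[]//|].
  by [].
- by rewrite /= cone_rad_vertex ltxx => -[].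
Qed.

(** Points of different radii are separated by the radius; points of the same
    positive radius have different base points, which [X] separates. *)
Lemma hausdorff_cone : hausdorff_space X -> hausdorff_space C.
Proof.
move=> hX; rewrite open_hausdorff => c c' cc'.
have sep_rad (b b' : C) : cone_rad b < cone_rad b' ->
    exists A B : set C, [/\ A b, B b', open A, open B & A `&` B = set0].
  move=> bb'; pose a := (cone_rad b + cone_rad b') / 2.
  exists [set c | cone_rad c < a], [set c | a < cone_rad c]; split.
  - by rewrite /= /a midf_lt.
  - by rewrite /= /a midf_lt.
  - exact: open_cone_rad_lt.
  - exact: open_cone_rad_gt.
  - by apply/seteqP; split => // e [/= /lt_trans/[apply]]; rewrite ltxx.
have [rr'|rr'|rr'] := ltgtP (cone_rad c) (cone_rad c').
- have [A [B [? ? ? ? AB]]] := sep_rad _ _ rr'.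
  by exists (A, B) => /=; rewrite !inE//; split => //; rewrite AB.
- have [A [B [? ? ? ? AB]]] := sep_rad _ _ rr'.
  by exists (B, A) => /=; rewrite !inE//; split => //; rewrite setIC AB.
have rN0 : cone_rad c != 0.
  apply: contra cc' => /eqP r0; apply/eqP; apply: cone_rad0 => //.
  by rewrite -rr'.
have rp : 0 < cone_rad c by rewrite lt0r rN0 cone_rad_ge0.
have bb' : cone_base point c != cone_base point c'.
  apply: contra cc'; rewrite /cone_base -rr' (negbTE rN0) => /eqP bE.
  rewrite (cone_pointK c) (cone_pointK c') bE; apply/eqP; congr cone_point.
  by apply/val_inj; exact: rr'.
move: hX; rewrite open_hausdorff => /(_ _ _ bb')[[A B] /= []].
rewrite !inE => Ac Bc' [oA oB AB].
exists ([set c : C | 0 < cone_rad c /\ A (cone_base point c)],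
        [set c : C | 0 < cone_rad c /\ B (cone_base point c)]) => /=.
  by rewrite !inE /= -rr'.
split; try exact: open_cone_base.
apply/eqP/seteqP; split => // e [[_ Ae] [_ Be]].
have : (A `&` B) (cone_base point e) by split.
by rewrite AB.
Qed.

Lemma hausdorff_prod (T U : topologicalType) :
  hausdorff_space T -> hausdorff_space U -> hausdorff_space (T * U)%type.
Proof.
move=> hT hU [t u] [t' u'] cl; congr pair.
- apply: hT => A B nA nB.
  have [] := cl (A `*` setT) (B `*` setT).
  + by exists (A, setT) => //; split => //; exact: filterT.
  + by exists (B, setT) => //; split => //; exact: filterT.
  + by move=> [a b] [[? _] [? _]]; exists a.
- apply: hU => A B nA nB.
  have [] := cl (setT `*` A) (setT `*` B).
  + by exists (setT, A) => //; split => //; exact: filterT.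
  + by exists (setT, B) => //; split => //; exact: filterT.
  + by move=> [a b] [[_ ?] [_ ?]]; exists b.
Qed.

Lemma continuous_cone_point :
  continuous (fun p : X * R => cone_point p.1 (absnng p.2) : C).
Proof.
move=> [x a] W; rewrite nbhsE => -[V [oV Vxa] VW]; apply: filterS VW _.
have [oV1 oV2] : cone_open V := oV.
have [a0|a0] := eqVneq a 0.
  have [|e e0 eV] := oV2.
    suff -> : cone_vertex R X = cone_point x (absnng a) by [].
    by apply: cone_rad0; rewrite cone_radE//= a0 normr0.
  have /= : nbhs (x, a) (@snd X R @^-1` [set r : R | `|r| < e]).
    apply: cvg_snd; rewrite a0 /=; apply/nbhs_ballP; exists e => // r.
    by rewrite /ball /= sub0r normrN.
  by apply: filterS => -[y b] /= be; apply: eV; rewrite /= cone_radE.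
have cabs : continuous (fun p : X * R => (p.1, `|p.2|) : X * R).
  move=> p; apply: (@cvg_pair _ _ _ (nbhs p) (nbhs p.1) (nbhs (`|p.2| : R))).
    exact: cvg_fst.
  apply: (@continuous_comp _ _ _ snd (@Num.norm R R)); first exact: cvg_snd.
  exact: (@norm_continuous R R^o).
have : nbhs (x, a) [set p : X * R | exists r : {nonneg R},
    [/\ 0 < r%:num, r%:num = `|p.2| & V (cone_point p.1 r)]].
  apply: (cabs (x, a) _ (open_nbhs_nbhs (conj oV1 _))).
  by exists (absnng a); rewrite /= normr_gt0.
apply: filterS => -[y b] /= [r [r0 rb Vr]].
by rewrite (_ : absnng b = r)//; apply/val_inj; rewrite /= rb.
Qed.

End cone_top.

(** * Borel maps into and out of the cone *)

Section graph.
Context {R : realType} {X Z : ptopologicalType}.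

(** Rectangles do not generate all Borel sets of a general product, so the
    measurability of [x |-> (x, (f x, g x))] is not automatic. It holds since
    [R * R] is second countable: an open subset of [X * (R * R)] is a countable
    union of products of an open set with a rational rectangle. *)
Lemma measurable_graph (Psi : X * (R * R) -> Z) (f g : borel X -> R) :
  continuous Psi -> measurable_fun setT f -> measurable_fun setT g ->
  measurable_fun setT ((fun x : X => Psi (x, (f x, g x))) : borel X -> borel Z).
Proof.
move=> cPsi mf mg; apply: borel_measurable_open => U oU.
pose V (b : rat * rat * (rat * rat)) : set X :=
  interior [set x | forall s t : R, s \in `]ratr b.1.1, ratr b.1.2[ ->
    t \in `]ratr b.2.1, ratr b.2.2[ -> U (Psi (x, (s, t)))].
pose W (b : rat * rat * (rat * rat)) : set (borel X) :=
  V b `&` (f @^-1` `]ratr b.1.1, ratr b.1.2[ `&`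
           g @^-1` `]ratr b.2.1, ratr b.2.2[).
have mW b : measurable (W b).
  apply: measurableI; first by apply: open_borel; exact: open_interior.
  apply: measurableI; rewrite -[X in measurable X]setTI.
    exact: mf.
  exact: mg.
have -> : (fun x : X => Psi (x, (f x, g x))) @^-1` U = \bigcup_b W b.
  apply/seteqP; split => [x /= Ux|x [b _ [Vx [fx gx]]]]; last first.
    by apply: (interior_subset Vx).
  have : nbhs (x, (f x, g x)) (Psi @^-1` U).
    by apply: cPsi; exact: open_nbhs_nbhs.
  case=> -[A B] /= [nA [[B1 B2] /= [nB1 nB2] BB]] AB.
  move/nbhs_ballP: nB1 => [e1 /= e10 eB1].
  move/nbhs_ballP: nB2 => [e2 /= e20 eB2].
  have l1 : f x - e1 < f x by rewrite ltrBlDr ltrDl.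
  have r1 : f x < f x + e1 by rewrite ltrDl.
  have l2 : g x - e2 < g x by rewrite ltrBlDr ltrDl.
  have r2 : g x < g x + e2 by rewrite ltrDl.
  have [p1] := rat_in_itvoo l1; rewrite in_itv => /andP[/= p1l p1r].
  have [q1] := rat_in_itvoo r1; rewrite in_itv => /andP[/= q1l q1r].
  have [p2] := rat_in_itvoo l2; rewrite in_itv => /andP[/= p2l p2r].
  have [q2] := rat_in_itvoo r2; rewrite in_itv => /andP[/= q2l q2r].
  exists ((p1, q1), (p2, q2)) => //; split; last first.
    by split; rewrite /= in_itv /=; apply/andP.
  apply: filterS nA => y Ay s t.
  rewrite !in_itv => /andP[/= s1 s2] /andP[/= t1 t2].
  apply: (AB (y, (s, t))); split => //; apply: BB; split => /=.
    by apply: eB1; rewrite /ball /= ltr_distl; apply/andP; split; lra.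
  by apply: eB2; rewrite /ball /= ltr_distl; apply/andP; split; lra.
exact: countable_bigcupT_measurable.
Qed.

End graph.

Section cone_measurable.
Context {R : realType} {X : ptopologicalType}.
Local Notation C := (cone R X).
Local Notation CC := (borel (C * C)%type).

Lemma open_preimage_cone (pr : C * C -> C) (U : set C) : continuous pr ->
  open U -> open (pr @^-1` U).
Proof. by move=> cpr; apply: open_comp => ? _; exact: cpr. Qed.

Lemma measurable_cone_rad (pr : C * C -> C) : continuous pr ->
  measurable_fun setT ((fun y => cone_rad (pr y)) : CC -> R).
Proof.
move=> cpr; apply: borel_measurable_ray => a.
exact: (open_preimage_cone cpr (open_cone_rad_gt a)).
Qed.

(** The base point map need not be continuous at the vertex, but this is the
    only exceptional point and it is closed. *)
Lemma measurable_cone_base (xbar : X) (pr : C * C -> C) : continuous pr ->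
  measurable_fun setT ((fun y => cone_base xbar (pr y)) : CC -> borel X).
Proof.
move=> cpr; apply: borel_measurable_open => U oU.
have mpos : measurable
    ([set y | 0 < cone_rad (pr y) /\ U (cone_base xbar (pr y))] : set CC).
  apply: open_borel.
  exact: (open_preimage_cone cpr (open_cone_base xbar oU)).
have m0 : measurable ([set y | ~ 0 < cone_rad (pr y)] : set CC).
  apply: measurableC; apply: open_borel.
  exact: (open_preimage_cone cpr (open_cone_rad_gt 0)).
have E y : ~ 0 < cone_rad (pr y) -> cone_base xbar (pr y) = xbar.
  by move=> /negP; rewrite lt0r cone_rad_ge0 andbT negbK /cone_base => ->.
have [Ux|Ux] := pselect (U xbar).
  rewrite (_ : _ @^-1` U =
    [set y | 0 < cone_rad (pr y) /\ U (cone_base xbar (pr y))] `|`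
    [set y | ~ 0 < cone_rad (pr y)]); first exact: measurableU.
  apply/seteqP; split => y /=.
    by move=> Uy; have [?|?] := pselect (0 < cone_rad (pr y)); [left|right].
  by move=> [[]//|/E ->].
rewrite (_ : _ @^-1` U =
  [set y | 0 < cone_rad (pr y) /\ U (cone_base xbar (pr y))])//.
apply/seteqP; split => y /=; last by case.
by move=> Uy; split => //; apply: contrapT => /E yE; rewrite yE in Uy.
Qed.

End cone_measurable.

Lemma continuous_pair (S T U : topologicalType) (f : S -> T) (g : S -> U) :
  continuous f -> continuous g -> continuous (fun x => (f x, g x)).
Proof.
move=> cf cg x.
exact: (@cvg_pair _ _ _ (nbhs x) (nbhs (f x)) (nbhs (g x)) _ _ _ f g
  (cf x) (cg x)).
Qed.

Lemma continuous_compose (S T U : topologicalType) (f : S -> T) (g : T -> U) :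
  continuous f -> continuous g -> continuous (g \o f).
Proof. by move=> cf cg x; apply: continuous_comp; [exact: cf|exact: cg]. Qed.

Section plan.
Context {R : realType} {X : ptopologicalType}.
Local Notation C := (cone R X).

Definition cone_pair (p : X * (R * R)) : C * C :=
  (cone_point p.1 (absnng p.2.1), cone_point p.1 (absnng p.2.2)).

Lemma continuous_cone_pair : continuous cone_pair.
Proof.
have cfst (T U : topologicalType) : continuous (@fst T U).
  by move=> p; exact: cvg_fst.
have csnd (T U : topologicalType) : continuous (@snd T U).
  by move=> p; exact: cvg_snd.
apply: continuous_pair.
- apply: (@continuous_compose _ _ _ (fun p : X * (R * R) => (p.1, p.2.1))
    (fun p : X * R => cone_point p.1 (absnng p.2))).
    apply: continuous_pair; first exact: cfst.
    exact: (continuous_compose (csnd _ _) (cfst _ _)).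
  exact: continuous_cone_point.
- apply: (@continuous_compose _ _ _ (fun p : X * (R * R) => (p.1, p.2.2))
    (fun p : X * R => cone_point p.1 (absnng p.2))).
    apply: continuous_pair; first exact: cfst.
    exact: (continuous_compose (csnd _ _) (csnd _ _)).
  exact: continuous_cone_point.
Qed.

End plan.

(** * The upper bound: plans over the diagonal *)

Section image_radon.
Context {R : realType} {X Z : ptopologicalType}.
Hypotheses (hX : hausdorff_space X) (hZ : hausdorff_space Z).

(** The graph map is continuous on the compact sets of Lusin's theorem, so it
    maps them to compact sets, and these exhaust the image measure. *)
Lemma radon_graph_image (gamma : {finite_measure set (borel X) -> \bar R})
    (m : {finite_measure set (borel Z) -> \bar R})
    (Psi : X * (R * R) -> Z) (f g : borel X -> R) :
  radon gamma -> continuous Psi ->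
  measurable_fun setT f -> measurable_fun setT g ->
  m = pushforward gamma
    ((fun x : X => Psi (x, (f x, g x))) : borel X -> borel Z)
    :> (set _ -> \bar R) ->
  radon m.
Proof.
move=> rg cPsi mf mg mE B mB e e0.
have mphi := measurable_graph cPsi mf mg.
pose phi (x : X) : Z := Psi (x, (f x, g x)).
have mB' : measurable (phi @^-1` B : set (borel X)).
  by rewrite -[X in measurable X]setTI; exact: mphi.
have e3 : 0 < e / 3 by rewrite divr_gt0.
have [K0 [cK0 K0B K0e]] := rg _ mB' _ e3.
have [K1 [cK1 K1e K1f]] := radon_lusin hX rg mf e3.
have [K2 [cK2 K2e K2g]] := radon_lusin hX rg mg e3.
have cl0 := compact_closed hX cK0.
have cl1 := compact_closed hX cK1.
have cl2 := compact_closed hX cK2.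
pose K := K0 `&` (K1 `&` K2).
have cK : compact K by apply: compact_closedI => //; exact: closedI.
have KK1 : K `<=` K1 by move=> x [_ []].
have KK2 : K `<=` K2 by move=> x [_ []].
have cphi : {within K, continuous phi}.
  have cf := continuous_subspaceW KK1 K1f.
  have cg := continuous_subspaceW KK2 K2g.
  have cid : {within K, continuous (id : X -> X)}.
    by apply: continuous_subspaceT => x; exact: cvg_id.
  apply: (@continuous_compose (subspace K) _ _
    (fun x => (x : X, (f x, g x))) Psi) => //.
  apply: (@continuous_pair (subspace K) X _ (fun x => (x : X))) => //.
  exact: (@continuous_pair (subspace K) _ _ f g).
have cphiK : compact (phi @` K) by exact: continuous_compact.
have mphiK : measurable (phi @` K : set (borel Z)).
  by apply: closed_borel; exact: compact_closed.
exists (phi @` K); split => //.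
  by move=> _ [x [K0x _] <-]; exact: K0B.
rewrite mE /pushforward -/phi.
have m0 : measurable (phi @^-1` B `\` K0 : set (borel X)).
  by apply: measurableD => //; exact: closed_borel.
have m1 : measurable (~` K1 : set (borel X)).
  by apply: measurableC; exact: closed_borel.
have m2 : measurable (~` K2 : set (borel X)).
  by apply: measurableC; exact: closed_borel.
have -> : e = e / 3 + (e / 3 + e / 3) by field.
rewrite !EFinD; apply: (le_trans _ (leeD K0e (leeD K1e K2e))).
apply: (le_trans _ (leeD (lexx _) (measureU2 gamma m1 m2))).
apply: (le_trans _ (measureU2 gamma m0 (measurableU _ _ m1 m2))).
apply: le_measure; rewrite ?inE.
- by rewrite -[X in measurable X]setTI; apply: mphi => //; exact: measurableD.
- by apply: measurableU => //; exact: measurableU.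
- move=> x /= [Bx nKx].
  have [K0x|?] := pselect (K0 x); last by left.
  have [K1x|?] := pselect (K1 x); last by right; left.
  have [K2x|?] := pselect (K2 x); last by right; right.
  by exfalso; apply: nKx; exists x.
Qed.

End image_radon.

Section cost.
Context {R : realType} {X : ptopologicalType}.
Variables (xbar : X) (d : X -> X -> \bar R).
Local Notation C := (cone R X).

(** The cost is [(r1 - r2) ^+ 2 + 2 * r1 * r2 * (1 - cos)]. *)
Lemma cone_dist2_ge_sqr (c1 c2 : C) :
  (cone_rad c1 - cone_rad c2) ^+ 2 <= cone_dist2 xbar d c1 c2.
Proof.
rewrite /cone_dist2; set t := fine _.
have := cos_le1 t; have := cone_rad_ge0 c1; have := cone_rad_ge0 c2.
move: (cone_rad c1) (cone_rad c2) (cos t) => r s k s0 r0 k1.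
have : 0 <= r * s * (1 - k) by rewrite !mulr_ge0// subr_ge0.
lra.
Qed.

Lemma cone_dist2_ge0 (c1 c2 : C) : 0 <= cone_dist2 xbar d c1 c2.
Proof. exact: le_trans (sqr_ge0 _) (cone_dist2_ge_sqr _ _). Qed.

Lemma cone_dist2_diag (x : X) (r s : {nonneg R}) : d x x = 0%E ->
  cone_dist2 xbar d (cone_point x r) (cone_point x s) = (r%:num - s%:num) ^+ 2.
Proof.
move=> dxx; rewrite /cone_dist2 !cone_radE !cone_baseE.
have [->|r0] := eqVneq r%:num 0; first by ring.
have [->|s0] := eqVneq s%:num 0; first by ring.
rewrite dxx min_l ?lee_fin ?pi_ge0//= cos0; ring.
Qed.

End cost.

Section upper.
Context {R : realType} {X : ptopologicalType}.
Variables (xbar : X).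
Local Notation C := (cone R X).
Local Notation CC := (borel (C * C)%type).
Implicit Types mu gamma : {finite_measure set (borel X) -> \bar R}.
Implicit Types alpha : {finite_measure set CC -> \bar R}.

(** Where [rho] vanishes the base point is [xbar] instead of [x], but there the
    weight given by the squared radius vanishes too. *)
Lemma lift_marginal gamma mu alpha (rho : borel X -> R) (pr : C * C -> C)
    (phi : borel X -> CC) :
  continuous pr -> measurable_fun setT phi ->
  alpha = pushforward gamma phi :> (set CC -> \bar R) ->
  (forall x, pr (phi x) = cone_point x (absnng (Num.sqrt (rho x)))) ->
  is_density gamma rho mu ->
  forall A : set (borel X), measurable A ->
    homogeneous_marginal xbar pr alpha A = mu A.
Proof.
move=> cpr mphi aE prphi [mrho rho0 muE] A mA.
rewrite /homogeneous_marginal /pushforward.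
have mb := measurable_cone_base xbar cpr; have mr := measurable_cone_rad cpr.
set B := _ @^-1` A.
have mB : measurable B by rewrite -[B]setTI; exact: mb.
rewrite (eq_measure_integral (pushforward gamma phi)); last first.
  by move=> D' _ _; exact: (congr1 (fun k => k D') aE).
rewrite ge0_integral_pushforward//; last 2 first.
  by apply/measurable_EFinP; apply: measurable_funTS; exact: measurable_funX.
  by move=> y _; rewrite lee_fin sqr_ge0.
rewrite muE// [LHS]integral_mkcond [RHS]integral_mkcond.
apply: eq_integral => x _; rewrite !patchE /=.
rewrite /= prphi cone_radE /= ger0_norm ?sqrtr_ge0// sqr_sqrtr//.
have [r0|r0] := eqVneq (rho x) 0; first by rewrite r0 !if_same.
suff -> : (x \in phi @^-1` B) = (x \in A) by [].
have E : cone_base xbar (pr (phi x)) = x.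
  by rewrite prphi cone_baseE /= normr_eq0 sqrtr_eq0 leNgt lt0r r0 rho0.
by apply/idP/idP; rewrite !inE /B /= E.
Qed.

Lemma HK2_le_hellinger (hX : hausdorff_space X) (d : X -> X -> \bar R)
    (dxx : forall x, d x x = 0%E) gamma mu1 mu2 (rho1 rho2 : borel X -> R) :
  radon gamma -> is_density gamma rho1 mu1 -> is_density gamma rho2 mu2 ->
  (HK2 xbar d mu1 mu2 <=
   \int[gamma]_x ((Num.sqrt (rho1 x) - Num.sqrt (rho2 x)) ^+ 2)%:E)%E.
Proof.
move=> rg d1 d2; have [mr1 r10 mu1E] := d1; have [mr2 r20 mu2E] := d2.
pose s1 x := Num.sqrt (rho1 x); pose s2 x := Num.sqrt (rho2 x).
have ms1 : measurable_fun setT s1 := measurable_sqrt_comp mr1.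
have ms2 : measurable_fun setT s2 := measurable_sqrt_comp mr2.
pose phi : borel X -> CC := fun x => cone_pair (x, (s1 x, s2 x)).
have mphi : measurable_fun setT phi.
  exact: (measurable_graph continuous_cone_pair ms1 ms2).
have [alpha aE] := finite_measure_pushforward gamma mphi.
have hC : hausdorff_space C by exact: hausdorff_cone.
have hCC := hausdorff_prod hC hC.
have cfst : continuous (@fst C C) by move=> p; exact: cvg_fst.
have csnd : continuous (@snd C C) by move=> p; exact: cvg_snd.
apply: (@le_trans _ _ (\int[alpha]_y (cone_dist2 xbar d y.1 y.2)%:E)%E).
  apply: ereal_inf_lbound; exists alpha => //; split.
  - exact: (@radon_graph_image _ X (C * C)%type hX hCC gamma alpha cone_pair
      s1 s2 rg (@continuous_cone_pair R X) ms1 ms2 aE).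
  - rewrite (eq_measure_integral (pushforward gamma phi)); last first.
      by move=> D' _ _; exact: (congr1 (fun k => k D') aE).
    rewrite ge0_integral_pushforward//; last 2 first.
      by apply/measurable_EFinP; apply: measurable_funD;
        apply: measurable_funX; exact: measurable_cone_rad.
      by move=> y _; rewrite lee_fin addr_ge0 ?sqr_ge0.
    rewrite preimage_setT (eq_integral (fun x => (rho1 x)%:E + (rho2 x)%:E)%E).
      rewrite ge0_integralD//=; try by move=> *; rewrite lee_fin.
      + by rewrite -mu1E// -mu2E// lte_add_pinfty// ltey_eq fin_num_measure.
      + exact/measurable_EFinP.
      + exact/measurable_EFinP.
    move=> x _ /=; rewrite !cone_radE /= !ger0_norm ?sqrtr_ge0//.
    by rewrite !sqr_sqrtr.
  - exact: (@lift_marginal gamma mu1 alpha rho1 fst phi).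
  - exact: (@lift_marginal gamma mu2 alpha rho2 snd phi).
apply: le_trans (integral_pushforward_le mphi aE _) _.
  by move=> y; rewrite lee_fin cone_dist2_ge0.
apply: ge0_le_integralT => x; first by rewrite lee_fin cone_dist2_ge0.
by rewrite lee_fin cone_dist2_diag//= !ger0_norm ?sqrtr_ge0.
Qed.

End upper.

(** * Weak duality for plans *)

Section duality.
Context {R : realType} {X : ptopologicalType}.
Variables (xbar : X) (d : X -> X -> \bar R).
Local Notation C := (cone R X).
Local Notation CC := (borel (C * C)%type).
Implicit Types mu : {finite_measure set (borel X) -> \bar R}.
Implicit Types alpha : {finite_measure set CC -> \bar R}.

Lemma homogeneous_marginal_integral mu alpha (pr : C * C -> C)
    (a : borel X -> R) :
  continuous pr ->
  (forall A : set (borel X), measurable A ->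
     homogeneous_marginal xbar pr alpha A = mu A) ->
  measurable_fun setT a -> (forall x, 0 <= a x) ->
  (\int[mu]_x (a x)%:E =
   \int[alpha]_y (a (cone_base xbar (pr y)) * cone_rad (pr y) ^+ 2)%:E)%E.
Proof.
move=> cpr h ma a0.
rewrite (@ge0_integral_weight _ _ CC (borel X) R alpha mu
  (fun y => cone_base xbar (pr y)) (fun y => cone_rad (pr y) ^+ 2)
  (EFin \o a)) //=.
- exact: measurable_cone_base.
- by apply: measurable_funX; exact: measurable_cone_rad.
- by move=> x; exact: sqr_ge0.
- by move=> A mA; rewrite -h.
- exact/measurable_EFinP.
Qed.

(** Integrate the pointwise inequality. The cost is bounded from below by the
    positive part of the remaining terms, which is measurable, so that
    additivity of the integral is used for measurable functions only. *)
Lemma plan_cost_ge_dual mu1 mu2 alpha (a b : borel X -> R) :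
  HK_plan xbar mu1 mu2 alpha ->
  measurable_fun setT a -> measurable_fun setT b ->
  (forall x, 0 <= a x) -> (forall x, 0 <= b x) ->
  (forall y : C * C, cone_rad y.1 ^+ 2 + cone_rad y.2 ^+ 2 <=
     cone_dist2 xbar d y.1 y.2 +
     (a (cone_base xbar y.1) * cone_rad y.1 ^+ 2 +
      b (cone_base xbar y.2) * cone_rad y.2 ^+ 2)) ->
  (mu1 setT + mu2 setT <= \int[alpha]_y (cone_dist2 xbar d y.1 y.2)%:E +
     (\int[mu1]_x (a x)%:E + \int[mu2]_x (b x)%:E))%E.
Proof.
move=> [_ _ h1 h2] ma mb a0 b0 key.
have cfst : continuous (@fst C C) by move=> p; exact: cvg_fst.
have csnd : continuous (@snd C C) by move=> p; exact: cvg_snd.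
have mass mu pr : continuous pr ->
    (forall A : set (borel X), measurable A ->
       homogeneous_marginal xbar pr alpha A = mu A) ->
    (mu setT = \int[alpha]_y (cone_rad (pr y) ^+ 2)%:E)%E.
  by move=> cpr h; rewrite -h.
rewrite (mass _ _ cfst h1) (mass _ _ csnd h2).
rewrite (homogeneous_marginal_integral cfst h1 ma a0).
rewrite (homogeneous_marginal_integral csnd h2 mb b0).
pose s1 (y : CC) := cone_rad y.1 ^+ 2; pose s2 (y : CC) := cone_rad y.2 ^+ 2.
pose A1 (y : CC) := a (cone_base xbar y.1) * s1 y.
pose B2 (y : CC) := b (cone_base xbar y.2) * s2 y.
have s10 y : 0 <= s1 y by exact: sqr_ge0.
have s20 y : 0 <= s2 y by exact: sqr_ge0.
have A10 y : 0 <= A1 y by exact: mulr_ge0.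
have B20 y : 0 <= B2 y by exact: mulr_ge0.
have ms1 : measurable_fun setT s1.
  by apply: measurable_funX; exact: (measurable_cone_rad cfst).
have ms2 : measurable_fun setT s2.
  by apply: measurable_funX; exact: (measurable_cone_rad csnd).
have mA1 : measurable_fun setT A1.
  apply: measurable_funM => //; apply: (measurableT_comp ma).
  exact: (measurable_cone_base xbar cfst).
have mB2 : measurable_fun setT B2.
  apply: measurable_funM => //; apply: (measurableT_comp mb).
  exact: (measurable_cone_base xbar csnd).
(* a measurable function squeezed between the dual terms and the cost *)
pose f (y : CC) := Num.max 0 (s1 y + s2 y - (A1 y + B2 y)).
have mf : measurable_fun setT f.
  apply: measurable_maxr => //; apply: measurable_funB; exact: measurable_funD.
have f0 y : 0 <= f y by rewrite le_max lexx.
apply: (@le_trans _ _ (\int[alpha]_y (f y)%:E +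
    (\int[alpha]_y (A1 y)%:E + \int[alpha]_y (B2 y)%:E))%E); last first.
  rewrite leeD2r//; apply: ge0_le_integralT => y; first by rewrite lee_fin.
  rewrite lee_fin ge_max cone_dist2_ge0/= lerBlDr; exact: key.
have mAB : measurable_fun setT (fun y => A1 y + B2 y) by exact: measurable_funD.
rewrite -!ge0_integral_addr// => [|y]; last by rewrite addr_ge0.
apply: ge0_le_integralT => y.
  by rewrite lee_fin; apply: addr_ge0; exact: sqr_ge0.
by rewrite lee_fin -lerBlDr le_max lexx orbT.
Qed.

End duality.

Section pointwise.
Context {R : realType}.

Lemma young_weight (r s k : R) : 0 < k ->
  2 * r * s <= k * r ^+ 2 + k^-1 * s ^+ 2.
Proof.
move=> k0; rewrite -subr_ge0.
have -> : k * r ^+ 2 + k^-1 * s ^+ 2 - 2 * r * s = k^-1 * (k * r - s) ^+ 2.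
  by field; rewrite gt_eqF.
by rewrite mulr_ge0 ?sqr_ge0// invr_ge0 ltW.
Qed.

Context {X : ptopologicalType}.
Variables (xbar : X) (d : X -> X -> \bar R).

(** At distance at least [pi] the cost is [(r1 + r2) ^+ 2]. *)
Lemma cone_dist2_far (l : R) (c1 c2 : cone R X) :
  ((pi : R)%:E <= l%:E * d (cone_base xbar c1) (cone_base xbar c2))%E ->
  cone_rad c1 ^+ 2 + cone_rad c2 ^+ 2 <= cone_dist2 xbar (scale_dist l d) c1 c2.
Proof.
move=> far; rewrite /cone_dist2 /scale_dist min_r//= cospi.
have := mulr_ge0 (cone_rad_ge0 c1) (cone_rad_ge0 c2); lra.
Qed.

Lemma cone_dist2_ge_young (l k : R) (c1 c2 : cone R X) : 0 < k ->
  cone_rad c1 ^+ 2 + cone_rad c2 ^+ 2 <=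
    cone_dist2 xbar (scale_dist l d) c1 c2 +
    (k * cone_rad c1 ^+ 2 + k^-1 * cone_rad c2 ^+ 2).
Proof.
move=> k0; have := cone_dist2_ge_sqr xbar (scale_dist l d) c1 c2.
have := young_weight (cone_rad c1) (cone_rad c2) k0.
lra.
Qed.

End pointwise.

(** * Densities with respect to a common measure *)

Section densities.
Context {R : realType} {X : ptopologicalType}.
Implicit Types mu gamma : {finite_measure set (borel X) -> \bar R}.

Lemma integral_density gamma mu (rho a : borel X -> R) :
  is_density gamma rho mu -> measurable_fun setT a -> (forall x, 0 <= a x) ->
  (\int[mu]_x (a x)%:E = \int[gamma]_x (a x * rho x)%:E)%E.
Proof.
move=> [mr r0 muE] ma a0.
rewrite (@ge0_integral_weight _ _ (borel X) (borel X) R gamma mu id rho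
  (EFin \o a)) //=.
exact/measurable_EFinP.
Qed.

(** The union of a compact set for each measure works for the sum, as
    enlarging a compact set only decreases the remainder. *)
Lemma radon_sum mu1 mu2 mu : radon mu1 -> radon mu2 -> hausdorff_space X ->
  (forall A, mu A = mu1 A + mu2 A)%E -> radon mu.
Proof.
move=> r1 r2 hX muE B mB e e0.
have e2 : 0 < e / 2 by rewrite divr_gt0.
have [K1 [cK1 K1B K1e]] := r1 B mB _ e2.
have [K2 [cK2 K2B K2e]] := r2 B mB _ e2.
have m1 : measurable (K1 : set (borel X)).
  by apply: closed_borel; exact: compact_closed.
have m2 : measurable (K2 : set (borel X)).
  by apply: closed_borel; exact: compact_closed.
exists (K1 `|` K2); split.
- exact: compactU.
- by move=> x [/K1B|/K2B].
- have m12 : measurable (B `\` (K1 `|` K2)).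
    by apply: measurableD => //; exact: measurableU.
  rewrite muE [e]splitr EFinD; apply: leeD.
    apply: le_trans K1e; apply: le_measure; rewrite ?inE//.
      exact: measurableD.
    by apply: setDS => x; left.
  apply: le_trans K2e; apply: le_measure; rewrite ?inE//.
    exact: measurableD.
  by apply: setDS => x; right.
Qed.

(** The sum of the two measures dominates both, and Radon-Nikodym applies; so
    the value picked in [hellinger2] is a genuine Hellinger integral. *)
Lemma hellinger2_values_nonempty mu1 mu2 : hausdorff_space X ->
  radon mu1 -> radon mu2 -> hellinger2_values mu1 mu2 !=set0.
Proof.
move=> hX r1 r2; have [gamma gE] := finite_measure_sum mu1 mu2.
have rg := radon_sum r1 r2 hX gE.
have dens mu : (forall A, mu A <= gamma A)%E ->
    exists rho, is_density gamma rho mu.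
  move=> le_mu; have [|f [f0 ffin /integrableP[mf _] fE]] :=
    @radon_nikodym_sigma_finite _ (borel X) R gamma mu.
    apply/null_content_dominatesP => A mA gA.
    by apply/eqP; rewrite eq_le measure_ge0 andbT -gA le_mu.
  exists (fun x => fine (f x)); split.
  - exact: measurableT_comp.
  - by move=> x; exact: fine_ge0.
  - by move=> A mA; rewrite fE//; apply: eq_integral => x _; rewrite fineK.
have [rho1 d1] : exists rho, is_density gamma rho mu1.
  by apply: dens => A; rewrite gE leeDl.
have [rho2 d2] : exists rho, is_density gamma rho mu2.
  by apply: dens => A; rewrite gE leeDr.
by eexists; exists gamma, rho1, rho2; split.
Qed.

(** Expansion of the square; the cross term is twice the Hellinger affinity.
    As the total mass is finite, both integrals are finite. *)
Lemma hellinger_affinity gamma mu1 mu2 (rho1 rho2 : borel X -> R) :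
  is_density gamma rho1 mu1 -> is_density gamma rho2 mu2 ->
  (\int[gamma]_x ((Num.sqrt (rho1 x) - Num.sqrt (rho2 x)) ^+ 2)%:E +
   \int[gamma]_x (2 * (Num.sqrt (rho1 x) * Num.sqrt (rho2 x)))%:E =
   mu1 setT + mu2 setT)%E.
Proof.
move=> [mr1 r10 mu1E] [mr2 r20 mu2E].
have ms1 := measurable_sqrt_comp mr1; have ms2 := measurable_sqrt_comp mr2.
rewrite mu1E// mu2E// -!ge0_integral_addr//; last 3 first.
- by apply: measurable_funX; exact: measurable_funB.
- by apply: measurable_funM => //; exact: measurable_funM.
- by move=> x; exact: sqr_ge0.
apply: eq_integral => x _; congr EFin.
rewrite -[in RHS](sqr_sqrtr (r10 x)) -[in RHS](sqr_sqrtr (r20 x)); ring.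
Qed.

Lemma hellinger_fin_num gamma mu1 mu2 (rho1 rho2 : borel X -> R) :
  is_density gamma rho1 mu1 -> is_density gamma rho2 mu2 ->
  (\int[gamma]_x ((Num.sqrt (rho1 x) - Num.sqrt (rho2 x)) ^+ 2)%:E)%E
    \is a fin_num /\
  (\int[gamma]_x (2 * (Num.sqrt (rho1 x) * Num.sqrt (rho2 x)))%:E)%E
    \is a fin_num.
Proof.
move=> d1 d2; apply/andP.
by rewrite -fin_numD (hellinger_affinity d1 d2) fin_numD !fin_num_measure.
Qed.

Lemma sqrt_density_sum_fin_num gamma mu1 mu2 (rho1 rho2 : borel X -> R) :
  is_density gamma rho1 mu1 -> is_density gamma rho2 mu2 ->
  (\int[gamma]_x (Num.sqrt (rho1 x) + Num.sqrt (rho2 x))%:E)%E \is a fin_num.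
Proof.
move=> [mr1 r10 mu1E] [mr2 r20 mu2E].
have r12 : measurable_fun setT (fun x => rho1 x + rho2 x).
  exact: measurable_funD.
have s0 x : 0 <= Num.sqrt (rho1 x) + Num.sqrt (rho2 x).
  by rewrite addr_ge0 ?sqrtr_ge0.
rewrite ge0_fin_numE; last by apply: integral_ge0 => x _; rewrite lee_fin.
apply: (@le_lt_trans _ _ (\int[gamma]_x (2 + (rho1 x + rho2 x))%:E)%E).
  apply: ge0_le_integralT => x; rewrite lee_fin//.
  have := sqr_sqrtr (r10 x); have := sqr_sqrtr (r20 x).
  have := sqr_ge0 (Num.sqrt (rho1 x) - 1).
  have := sqr_ge0 (Num.sqrt (rho2 x) - 1).
  nra.
have mc2 : measurable_fun setT (fun _ : borel X => 2 : R).
  exact: measurable_cst.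
rewrite (ge0_integral_addr gamma mc2 r12)//; last by move=> x; exact: addr_ge0.
rewrite (ge0_integral_addr gamma mr1 mr2)// -mu1E// -mu2E// integral_cst//.
by rewrite ltey_eq fin_numD fin_numM ?fin_num_measure// fin_numD
  !fin_num_measure.
Qed.

End densities.

(** * Dual potentials for the scaled cost *)

Section potentials.
Context {R : realType} {X : ptopologicalType}.
Implicit Types mu gamma : {finite_measure set (borel X) -> \bar R}.

(** With [g = ln theta] and [- g] these are the two dual potentials:
    [(1 + t) * theta] and [(1 + t) / theta], plus a constant [t] and a large
    penalty [t^-1] on the set [N], which will carry little mass. The constant
    and the penalty cover, with Young's inequality for the weights [t] and
    [t^-1], the case of one point in [N]. *)
Definition potential (N : set X) (t : R) (g : X -> R) (x : X) : R :=
  (1 + t) * expR (g x) + (t^-1 * \1_N x + t).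

Variables (N : set X) (t : R).
Hypotheses (mN : measurable (N : set (borel X))) (t0 : 0 < t).

Let penalty (x : borel X) : R := t^-1 * \1_N x + t.

Let tV0 : 0 <= t^-1. Proof. by rewrite invr_ge0 ltW. Qed.

Let t10 : 0 <= 1 + t. Proof. by rewrite addr_ge0// ltW. Qed.

Let penalty_ge0 x : 0 <= penalty x.
Proof. by rewrite addr_ge0 ?mulr_ge0// ltW. Qed.

Let measurable_indicN : measurable_fun setT (\1_N : borel X -> R).
Proof. exact: measurable_indic. Qed.

Let measurable_penalty : measurable_fun setT penalty.
Proof. by apply: measurable_funD => //; exact: measurable_funM. Qed.

Lemma potential_ge0 (g : X -> R) x : 0 <= potential N t g x.
Proof. by rewrite addr_ge0 ?mulr_ge0 ?expR_ge0//; exact: penalty_ge0. Qed.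

Lemma measurable_potential (g : borel X -> R) : measurable_fun setT g ->
  measurable_fun setT (potential N t g : borel X -> R).
Proof.
move=> mg; apply: measurable_funD; last exact: measurable_penalty.
by apply: measurable_funM => //; exact: (measurableT_comp (@measurable_expR R)).
Qed.

Let integral_penalty mu :
  (\int[mu]_x (penalty x)%:E = (t^-1)%:E * mu N + t%:E * mu setT)%E.
Proof.
rewrite ge0_integral_addr//; last 3 first.
- exact: measurable_funM.
- by move=> x; rewrite mulr_ge0.
- by move=> _; exact: ltW.
by rewrite (ge0_integral_mulr mu measurable_indicN)// integral_indic// setIT
  integral_cst.
Qed.

(** With [theta = (s2 + t) / (s1 + t)] one has [theta * s1 <= s2 + t] and
    [s2 / theta <= s1 + t]. The shift by [t] keeps [theta] positive and finite
    where one of the densities vanishes. *)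
Lemma weighted_density_le (s1 s2 : R) : 0 <= s1 -> 0 <= s2 ->
  expR (ln (s2 + t) - ln (s1 + t)) * s1 ^+ 2 +
  expR (- (ln (s2 + t) - ln (s1 + t))) * s2 ^+ 2 <=
  2 * (s1 * s2) + t * (s1 + s2).
Proof.
move=> s10 s20.
have p0 : 0 < s1 + t by rewrite ltr_wpDl.
have q0 : 0 < s2 + t by rewrite ltr_wpDl.
rewrite opprB !expRD !expRN !lnK ?posrE//.
have H (s p q : R) : 0 <= s -> 0 < p -> 0 < q -> s <= p ->
    q / p * s ^+ 2 <= q * s.
  move=> s0 p_gt0 q_gt0 sp.
  rewrite -mulrA ler_pM2l// mulrC ler_pdivrMr// expr2.
  by rewrite ler_wpM2l.
have s1p : s1 <= s1 + t by rewrite lerDl ltW.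
have s2q : s2 <= s2 + t by rewrite lerDl ltW.
have := H _ _ _ s10 p0 q0 s1p; have := H _ _ _ s20 q0 p0 s2q.
lra.
Qed.

Lemma integral_potentials_le gamma mu1 mu2 (rho1 rho2 : borel X -> R)
    (g : X -> R) :
  is_density gamma rho1 mu1 -> is_density gamma rho2 mu2 ->
  g = (fun x => ln (Num.sqrt (rho2 x) + t) - ln (Num.sqrt (rho1 x) + t)) ->
  measurable_fun setT (g : borel X -> R) ->
  (\int[mu1]_x (potential N t g x)%:E +
   \int[mu2]_x (potential N t (fun x => - g x) x)%:E <=
   (1 + t)%:E *
     (\int[gamma]_x (2 * (Num.sqrt (rho1 x) * Num.sqrt (rho2 x)))%:E +
      t%:E * \int[gamma]_x (Num.sqrt (rho1 x) + Num.sqrt (rho2 x))%:E) +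
   ((t^-1)%:E * (mu1 N + mu2 N) + t%:E * (mu1 setT + mu2 setT)))%E.
Proof.
move=> d1 d2 gE mg; have [mr1 r10 _] := d1; have [mr2 r20 _] := d2.
have mNg : measurable_fun setT (fun x : borel X => - g x).
  exact: measurableT_comp.
have ma := measurable_potential mg; have mb := measurable_potential mNg.
have a0 := potential_ge0 g; have b0 := potential_ge0 (fun x => - g x).
pose s1 x := Num.sqrt (rho1 x); pose s2 x := Num.sqrt (rho2 x).
have ms1 : measurable_fun setT s1 := measurable_sqrt_comp mr1.
have ms2 : measurable_fun setT s2 := measurable_sqrt_comp mr2.
have s10 x : 0 <= s1 x by exact: sqrtr_ge0.
have s20 x : 0 <= s2 x by exact: sqrtr_ge0.
have m12 : measurable_fun setT (fun x => 2 * (s1 x * s2 x)).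
  by apply: measurable_funM => //; exact: measurable_funM.
have p12 : measurable_fun setT (fun x => s1 x + s2 x) by exact: measurable_funD.
have mtp : measurable_fun setT (fun x => t * (s1 x + s2 x)).
  exact: measurable_funM.
have mst : measurable_fun setT
    (fun x => 2 * (s1 x * s2 x) + t * (s1 x + s2 x)).
  exact: measurable_funD.
have mpr (rho : borel X -> R) (a : borel X -> R) : measurable_fun setT rho ->
    measurable_fun setT a -> measurable_fun setT (fun x => a x * rho x).
  by move=> mr mf; exact: measurable_funM.
have s12p x : 0 <= s1 x + s2 x by exact: addr_ge0.
have s120 x : 0 <= 2 * (s1 x * s2 x) by rewrite !mulr_ge0.
have tp0 x : 0 <= t * (s1 x + s2 x) by rewrite mulr_ge0// ltW.
have st0 x : 0 <= 2 * (s1 x * s2 x) + t * (s1 x + s2 x) by exact: addr_ge0.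
have w10 x : 0 <= penalty x * rho1 x by exact: mulr_ge0.
have w20 x : 0 <= penalty x * rho2 x by exact: mulr_ge0.
rewrite (integral_density d1 ma a0) (integral_density d2 mb b0).
rewrite -(ge0_integral_addr gamma (mpr _ _ mr1 ma) (mpr _ _ mr2 mb))//;
  try by move=> x; exact: mulr_ge0.
apply: (@le_trans _ _ (\int[gamma]_x
    ((1 + t) * (2 * (s1 x * s2 x) + t * (s1 x + s2 x)) +
     (penalty x * rho1 x + penalty x * rho2 x))%:E)%E).
  apply: ge0_le_integralT => x; rewrite lee_fin.
    by rewrite addr_ge0//; exact: mulr_ge0.
  have := weighted_density_le (s10 x) (s20 x).
  have -> : ln (s2 x + t) - ln (s1 x + t) = g x by rewrite gE.
  rewrite !sqr_sqrtr// => /(ler_wpM2l t10).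
  by rewrite /potential -/(penalty x); lra.
rewrite ge0_integral_addr//; last 4 first.
- exact: measurable_funM.
- by apply: measurable_funD; exact: mpr.
- by move=> x; rewrite mulr_ge0.
- by move=> x; rewrite addr_ge0.
apply: leeD.
  have tI := ge0_integral_mulr gamma p12 (ltW t0) s12p.
  by rewrite ge0_integral_mulr// ge0_integral_addr// tI.
rewrite (ge0_integral_addr gamma (mpr _ _ mr1 measurable_penalty)
  (mpr _ _ mr2 measurable_penalty))//.
rewrite -(integral_density d1 measurable_penalty penalty_ge0).
rewrite -(integral_density d2 measurable_penalty penalty_ge0).
by rewrite !integral_penalty addeACA -!ge0_muleDr.
Qed.

End potentials.

Section lower_bound.
Context {R : realType} {X : ptopologicalType}.
Variables (d : X -> X -> \bar R).
Hypothesis hd : ext_metric_topological d.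
Implicit Types mu gamma : {finite_measure set (borel X) -> \bar R}.

(** For base points [x] and [y] there are four cases. If [x] or [y] is outside
    [K], the penalty suffices. If both are in [K] and [d x y] is at least [c],
    the scaled distance is at least [pi]. If both are in [K] and [d x y < c], then
    [g x] and [g y] differ by less than [ln (1 + t)], and Young's inequality
    with weight [expR (g x)] applies. *)
Lemma potentials_eventually_admissible (xbar : X) (g : X -> R) (K : set X)
    (t : R) :
  compact K -> {within K, continuous g} -> 0 < t ->
  exists2 l0 : R, 0 < l0 & forall l, l0 <= l -> forall c1 c2 : cone R X,
  cone_rad c1 ^+ 2 + cone_rad c2 ^+ 2 <=
    cone_dist2 xbar (scale_dist l d) c1 c2 +
    (potential (~` K) t g (cone_base xbar c1) * cone_rad c1 ^+ 2 +
     potential (~` K) t (fun x => - g x) (cone_base xbar c2) *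
       cone_rad c2 ^+ 2).
Proof.
move=> cK cg t0.
have e0 : 0 < ln (1 + t) by rewrite ln_gt0// ltrDl.
have [c c0 cgd] := compact_unif_continuous_lsc hd cK cg e0.
(* from this scale on, distances at least [c] are stretched to at least [pi] *)
exists (pi / c); first by rewrite divr_gt0// pi_gt0.
move=> l ll c1 c2; set x := cone_base xbar c1; set y := cone_base xbar c2.
have ti0 : 0 < t^-1 by rewrite invr_gt0.
set a := potential _ _ _ x; set b := potential _ _ _ y.
have a0 : 0 <= a by exact: potential_ge0.
have b0 : 0 <= b by exact: potential_ge0.
have i1 : 0 <= t^-1 * \1_(~` K) x by rewrite mulr_ge0// ltW.
have i2 : 0 <= t^-1 * \1_(~` K) y by rewrite mulr_ge0// ltW.
have E1 := expR_gt0 (g x); have E2 := expR_gt0 (- g y).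
have F1 : 0 <= (1 + t) * expR (g x) by rewrite mulr_ge0 ?addr_ge0 // ltW.
have F2 : 0 <= (1 + t) * expR (- g y) by rewrite mulr_ge0 ?addr_ge0 // ltW.
have q1 := sqr_ge0 (cone_rad c1); have q2 := sqr_ge0 (cone_rad c2).
suff [far|[k [k0 ka kb]]] : (pi%:E <= l%:E * d x y)%E \/
    exists k, [/\ 0 < k, k <= a & k^-1 <= b].
- apply: le_trans (cone_dist2_far far) _.
  by rewrite lerDl addr_ge0// mulr_ge0.
- have := cone_dist2_ge_young xbar d l c1 c2 k0.
  have := ler_wpM2r q1 ka; have := ler_wpM2r q2 kb.
  lra.
have [Kx|nKx] := pselect (K x); last first.
  right; exists t^-1; split => //.
    by rewrite /a /potential indicE mem_set// mulr1; lra.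
  by rewrite invrK /b /potential; lra.
have [Ky|nKy] := pselect (K y); last first.
  right; exists t; split => //; first by rewrite /a /potential; lra.
  by rewrite /b /potential indicE mem_set// mulr1; lra.
have [dc|cd] := ltP (d x y) c%:E; last first.
  left; apply: (@le_trans _ _ (l%:E * c%:E)%E).
    by rewrite -EFinM lee_fin -ler_pdivrMr.
  apply: lee_wpmul2l => //.
  by rewrite lee_fin (le_trans _ ll)// divr_ge0 ?pi_ge0// ltW.
right; exists (expR (g x)); split => //; first by rewrite /a /potential; nra.
apply: (@le_trans _ _ ((1 + t) * expR (- g y))); last first.
  by rewrite /b /potential; lra.
have t1 : 0 < 1 + t by rewrite addr_gt0.
rewrite -expRN -[leRHS](congr1 (fun z => z * _) (lnK _)) ?posrE// -expRD.
rewrite ler_expR.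
by have := cgd x y Kx Ky dc; rewrite ltr_distl => /andP[]; lra.
Qed.

(** The potentials of parameter [t], for a compact set missing mass at most
    [t ^+ 2], lose at most a constant times [t] in the dual problem. *)
Lemma hellinger_le_HK2 (xbar : X) gamma mu1 mu2 (rho1 rho2 : borel X -> R)
    (e : R) :
  radon mu1 -> radon mu2 ->
  is_density gamma rho1 mu1 -> is_density gamma rho2 mu2 -> 0 < e ->
  exists2 l0 : R, 0 < l0 & forall l, l0 <= l ->
  (\int[gamma]_x ((Num.sqrt (rho1 x) - Num.sqrt (rho2 x)) ^+ 2)%:E
    <= HK2 xbar (scale_dist l d) mu1 mu2 + e%:E)%E.
Proof.
move=> r1 r2 d1 d2 e0; have hX := emt_hausdorff hd.
have [mr1 _ _] := d1; have [mr2 _ _] := d2.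
pose s1 x := Num.sqrt (rho1 x); pose s2 x := Num.sqrt (rho2 x).
have ms1 : measurable_fun setT s1 := measurable_sqrt_comp mr1.
have ms2 : measurable_fun setT s2 := measurable_sqrt_comp mr2.
have vIM := hellinger_affinity d1 d2.
have [vfin Ifin] := hellinger_fin_num d1 d2.
have Jfin := sqrt_density_sum_fin_num d1 d2.
have Mfin : (mu1 setT + mu2 setT)%E \is a fin_num.
  by rewrite fin_numD !fin_num_measure.
set v := (\int[gamma]_x _)%E in vIM vfin *.
set I := (\int[gamma]_x _)%E in vIM Ifin.
set J := (\int[gamma]_x _)%E in Jfin.
set M := (mu1 setT + mu2 setT)%E in vIM Mfin.
have I0 : 0 <= fine I.
  by apply: fine_ge0; apply: integral_ge0 => x _; rewrite lee_fin !mulr_ge0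
    ?sqrtr_ge0.
have J0 : 0 <= fine J.
  by apply: fine_ge0; apply: integral_ge0 => x _; rewrite lee_fin addr_ge0
    ?sqrtr_ge0.
have M0 : 0 <= fine M by apply: fine_ge0; exact: adde_ge0.
(* the total error is at most [t * D] for [t <= 1], where [I], [J], [M] are
   the integrals of [2 * s1 * s2], of [s1 + s2], and the total mass *)
pose D := fine I + 2 * fine J + 1 + fine M.
have D0 : 0 < D by rewrite /D; lra.
pose t := Num.min 1 (e / D).
have t0 : 0 < t by rewrite lt_min ltr01 divr_gt0.
have t1 : t <= 1 by rewrite ge_min lexx.
have tD : t * D <= e by rewrite -ler_pdivlMr// ge_min lexx orbT.
have [mu muE] := finite_measure_sum mu1 mu2.
have rmu := radon_sum r1 r2 hX muE.
pose g (x : X) := ln (s2 x + t) - ln (s1 x + t).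
have mg : measurable_fun setT (g : borel X -> R).
  have mlnD (f : borel X -> R) : measurable_fun setT f ->
      measurable_fun setT (fun x => ln (f x + t)).
    by move=> mf; apply: measurableT_comp => //; exact: measurable_funD.
  by apply: measurable_funB; exact: mlnD.
have t20 : 0 < t ^+ 2 by rewrite exprn_gt0.
have [K [cK Ke cg]] := radon_lusin hX rmu mg t20.
have [l0 l00 key] := potentials_eventually_admissible xbar cK cg t0.
have mKc : measurable (~` K : set (borel X)).
  by apply: measurableC; apply: closed_borel; exact: compact_closed.
exists l0 => // l ll.
have mNg : measurable_fun setT (fun x : borel X => - g x).
  exact: measurableT_comp.
have AB := integral_potentials_le mKc t0 d1 d2 erefl mg.
rewrite -leeBlDr//; apply: le_ereal_inf_tmp => _ [alpha pl <-].
have := plan_cost_ge_dual pl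
  (measurable_potential t mKc mg) (measurable_potential t mKc mNg)
  (potential_ge0 _ t0 _) (potential_ge0 _ t0 _)
  (fun y => key l ll y.1 y.2).
set c := (\int[alpha]_y _)%E; rewrite -/M => Mle.
have c0 : (0 <= c)%E.
  by apply: integral_ge0 => y _; rewrite lee_fin cone_dist2_ge0.
have {AB}AB := le_trans Mle (leeD (lexx c) AB).
have NK : ((t^-1)%:E * (mu1 (~` K) + mu2 (~` K)) <= t%:E)%E.
  rewrite -muE -lee_pdivlMl ?invr_gt0// invrK.
  by apply: le_trans Ke _; rewrite -EFinM lee_fin expr2.
move: (le_trans AB (leeD (lexx c) (leeD (lexx _) (leeD NK (lexx _))))) c0.
rewrite -/I -/J -/M; case: c {Mle AB} => [c||] //; last first.
  by move=> _ _; exact: leey.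
move: vIM; rewrite -(fineK vfin) -(fineK Ifin) -(fineK Jfin) -(fineK Mfin).
rewrite -!(EFinD, EFinM) !lee_fin => -[uE] H _.
have ttJ : t * (t * fine J) <= t * fine J.
  by rewrite ler_wpM2l ?(ltW t0)// -[leRHS]mul1r ler_wpM2r.
move: tD; rewrite /D; lra.
Qed.

End lower_bound.

(** * Monotonicity in the scale *)

Section monotone.
Context {R : realType} {X : ptopologicalType}.
Variables (xbar : X) (d : X -> X -> \bar R).
Hypothesis d0 : forall x y, (0 <= d x y)%E.

Lemma truncated_angle (l : R) (x y : X) : 0 <= l ->
  exists2 a : R, a \in `[0, pi] & Order.min (scale_dist l d x y) pi%:E = a%:E.
Proof.
move=> l0; have : (0 <= scale_dist l d x y)%E by rewrite mule_ge0// lee_fin.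
case: (scale_dist l d x y) => [a||] // a0.
  exists (Num.min a pi); last by rewrite -EFin_min.
  by rewrite in_itv/= le_min pi_ge0 ge_min lexx orbT -lee_fin a0.
by exists pi; rewrite ?in_itv/= ?pi_ge0 ?lexx// min_r// leey.
Qed.

Lemma cone_dist2_mono (l1 l2 : R) (c1 c2 : cone R X) : 0 <= l1 -> l1 <= l2 ->
  cone_dist2 xbar (scale_dist l1 d) c1 c2 <=
  cone_dist2 xbar (scale_dist l2 d) c1 c2.
Proof.
move=> l10 l12; rewrite /cone_dist2.
set x := cone_base _ c1; set y := cone_base _ c2.
have [a a_itv aE] := truncated_angle x y l10.
have [b b_itv bE] := truncated_angle x y (le_trans l10 l12).
have ab : a <= b.
  rewrite -lee_fin -aE -bE; apply: le_min2 => //.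
  by apply: lee_wpmul2r => //; rewrite lee_fin.
rewrite aE bE /= lerD2l lerN2 ler_wpM2l ?mulr_ge0 ?cone_rad_ge0//.
by move: ab; rewrite le_eqVlt => /predU1P[->//|ab]; apply: ltW; rewrite ltr_cos.
Qed.

Lemma HK2_ge0 (d' : X -> X -> \bar R)
    (mu1 mu2 : {finite_measure set (borel X) -> \bar R}) :
  (0 <= HK2 xbar d' mu1 mu2)%E.
Proof.
apply: le_ereal_inf_tmp => _ [alpha pl <-]; apply: integral_ge0 => y _.
by rewrite lee_fin cone_dist2_ge0.
Qed.

Lemma HK2_mono (l1 l2 : R)
    (mu1 mu2 : {finite_measure set (borel X) -> \bar R}) :
  0 <= l1 -> l1 <= l2 ->
  (HK2 xbar (scale_dist l1 d) mu1 mu2 <= HK2 xbar (scale_dist l2 d) mu1 mu2)%E.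
Proof.
move=> l10 l12; apply: le_ereal_inf_tmp => _ [alpha pl <-].
apply: ge_ereal_inf.
exists (\int[alpha]_y (cone_dist2 xbar (scale_dist l1 d) y.1 y.2)%:E)%E.
  by exists alpha.
apply: ge0_le_integralT => y; rewrite lee_fin; first exact: cone_dist2_ge0.
exact: cone_dist2_mono.
Qed.

End monotone.

(** * Convergence *)

Unset Implicit Arguments.
Set Strict Implicit.

Theorem theorem7p22 (R : realType) (X : ptopologicalType)
    (d : X -> X -> \bar R) (hd : ext_metric_topological d) (xbar : X)
    (mu1 mu2 : {finite_measure set (borel X) -> \bar R})
    (hmu1 : radon mu1) (hmu2 : radon mu2) :
  (forall l1 l2 : R, 0 < l1 -> l1 <= l2 ->
     (HK xbar (scale_dist l1 d) mu1 mu2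
        <= HK xbar (scale_dist l2 d) mu1 mu2)%E) /\
  HK xbar (scale_dist l d) mu1 mu2 @[l --> +oo%R] --> Hell mu1 mu2.
Proof.
have hX := emt_hausdorff hd; have d0 := emt_ge0 hd.
split=> [l1 l2 l10 l12|].
  rewrite /HK lee_sqrt ?HK2_ge0//; exact: HK2_mono (ltW l10) l12.
rewrite /Hell /hellinger2; set v := xget _ _.
have [gamma [rho1 [rho2 [rg d1 d2 vE]]]] : hellinger2_values mu1 mu2 v.
  have [w hw] := hellinger2_values_nonempty hX hmu1 hmu2.
  exact: xgetPex (ex_intro _ w hw).
have vfin : v \is a fin_num by rewrite vE; exact: (hellinger_fin_num d1 d2).1.
have le_v l : (HK2 xbar (scale_dist l d) mu1 mu2 <= v)%E.
  rewrite vE; apply: HK2_le_hellinger => // x.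
  by rewrite /scale_dist (proj2 (emt_eq0 hd x x))// mule0.
have fin l : HK2 xbar (scale_dist l d) mu1 mu2 \is a fin_num.
  by rewrite ge0_fin_numE ?HK2_ge0// (le_lt_trans (le_v l))// ltey_eq vfin.
pose h l := fine (HK2 xbar (scale_dist l d) mu1 mu2).
have hE l : HK2 xbar (scale_dist l d) mu1 mu2 = (h l)%:E by rewrite /h fineK.
have cvg_h : h l @[l --> +oo%R] --> fine v.
  apply/(@cvgrPdist_le _ R^o) => e e0.
  have [l0 l00 lb] := hellinger_le_HK2 hd xbar hmu1 hmu2 d1 d2 e0.
  near=> l; have ll : l0 <= l.
    by near: l; apply: nbhs_pinfty_ge; exact: num_real.
  have := lb _ ll; have := le_v l.
  rewrite -vE hE -(fineK vfin) -EFinD !lee_fin => vl vu.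
  by change (`|fine v - h l| <= e); rewrite ler_norml; apply/andP; split; lra.
rewrite (_ : sqrte v = (Num.sqrt (fine v))%:E); last first.
  by rewrite -[in LHS](fineK vfin).
rewrite (_ : (fun l => _) = (fun l => (Num.sqrt (h l))%:E)); last first.
  by apply/funext => l; rewrite /HK hE.
apply: cvg_EFin; first by near=> l.
have sqrt_c := @sqrt_continuous R (fine v).
have cvg_sqrt := cvg_comp _ _ cvg_h sqrt_c.
exact: cvg_sqrt.
Unshelve. all: by end_near. Qed.
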